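(* For any two infinite cardinals $\mu<\kappa$ there is a $\mathcal C(\kappa)$-space $X$ that is the disjoint union of $\mu$ dense submaximal subspaces but is not $\mu^+$-extraresolvable. (Of course, $X$ is then $\mu$-resolvable but not $\mu^+$-resolvable, hence not maximally resolvable.)
   Context: For a space $X$, $\Delta(X)$ is the minimum cardinality of a nonempty open subset of $X$, and $\operatorname{nwd}(X)$ is the minimum cardinality of a somewhere dense (i.e. not nowhere dense) subset of $X$. $X$ is NODEC if all nowhere dense subsets of $X$ are closed (hence closed discrete). $D(2)$ is the discrete two-point space. For an infinite cardinal $\kappa$, a $\mathcal C(\kappa)$-space is a dense NODEC subspace $X$ of the Cantor cube $D(2)^{2^\kappa}$ with $|X|=\operatorname{nwd}(X)=\Delta(X)=\kappa$. A space is submaximal if all of its dense subsets are open. $X$ is $\lambda$-resolvable if it contains $\lambda$ many pairwise disjoint dense subsets, and maximally resolvable if it is $\Delta(X)$-resolvable. $X$ is $\lambda$-extraresolvable if there are $\lambda$ many dense subsets of $X$ such that any two of them have nowhere dense intersection. *)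

(* Defs.v *)
From HB Require Import structures.
From mathcomp Require Import all_boot all_classical.
From mathcomp Require Import topology.

Set Implicit Arguments.
Unset Strict Implicit.
Unset Printing Implicit Defensive.

Local Open Scope classical_set_scope.
Local Open Scope card_scope.

(* A cardinal is represented by (the cardinality of) an arbitrary type. *)

Definition card_lt (T U : Type) (A : set T) (B : set U) : Prop :=
  A #<= B /\ ~ (B #<= A).

Definition is_card_succ (M L : Type) : Prop :=
  card_lt [set: M] [set: L] /\
  forall N : Type, card_lt [set: M] [set: N] -> [set: L] #<= [set: N].

Definition is_min_card (T : Type) (F : set (set T)) (K : Type) : Prop :=
  (exists2 A, F A & A #= [set: K]) /\ forall A, F A -> [set: K] #<= A.

Section topological_notions.
Variable T : topologicalType.

Definition nowhere_dense (A : set T) : Prop := interior (closure A) = set0.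

(* The cardinal functions Delta and nwd are given by their graphs:
   [is_Delta K] says that Delta(T) = |K|. *)
Definition is_Delta (K : Type) : Prop :=
  is_min_card [set U : set T | open U /\ U !=set0] K.

Definition is_nwd (K : Type) : Prop :=
  is_min_card [set A : set T | ~ nowhere_dense A] K.

Definition nodec : Prop := forall A : set T, nowhere_dense A -> closed A.

Definition submaximal : Prop := forall A : set T, dense A -> open A.

Definition resolvable (L : Type) : Prop :=
  exists D : set (set T),
    [/\ D #= [set: L], (forall A, D A -> dense A) & trivIset D id].

Definition maximally_resolvable : Prop :=
  exists2 K : Type, is_Delta K & resolvable K.

Definition extraresolvable (L : Type) : Prop :=
  exists D : set (set T),
    [/\ D #= [set: L], (forall A, D A -> dense A) &
        forall A B, D A -> D B -> A <> B -> nowhere_dense (A `&` B)].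

End topological_notions.

Arguments is_Delta : clear implicits.
Arguments is_nwd : clear implicits.
Arguments nodec : clear implicits.
Arguments submaximal : clear implicits.
Arguments resolvable : clear implicits.
Arguments maximally_resolvable : clear implicits.
Arguments extraresolvable : clear implicits.

(* [bool] carries the discrete topology. *)
Definition cantor_cube (I : Type) : topologicalType :=
  prod_topology (fun _ : I => bool).

(* The exponent 2^|K| is the cardinality of [set K].  [set_type X] is the
   subtype of X with the subspace topology, unlike [subspace X]. *)
Definition C_space (K : Type) (X : set (cantor_cube (set K))) : Prop :=
  [/\ dense X, nodec (set_type X), [set: set_type X] #= [set: K],
      is_nwd (set_type X) K & is_Delta (set_type X) K].

Arguments C_space : clear implicits.

Definition disjoint_union_of_dense_submaximal (T : topologicalType) (M : Type) : Prop :=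
  exists D : set (set T),
    [/\ D #= [set: M], trivIset D id, \bigcup_(A in D) A = [set: T] &
        forall A, D A -> dense A /\ submaximal (set_type A)].

(* Main.v *)
Require Import Defs.
From HB Require Import structures.
From mathcomp Require Import all_boot all_classical.
From mathcomp Require Import topology.

Set Implicit Arguments.
Unset Strict Implicit.
Unset Printing Implicit Defensive.

Local Open Scope classical_set_scope.
Local Open Scope card_scope.

(** Split [K] into pieces indexed by [M], and let a clopen partition of [K] for
    each index [j : set K] define a map from [K] to the Cantor cube; [X] is its
    image.  All the required properties follow from two features of the pieces:
    every box (the points with finitely many prescribed coordinates) meets
    every piece in [K] many points, and every subset of [X] either is closed or
    contains the trace of a nonempty open set on some piece
    ([maximal_closing]).

    Granted this dichotomy, a nowhere dense set is closed because every piece is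
    dense, a set of fewer than [K] points contains no such trace and hence is
    nowhere dense, and the complement of a dense subset of a piece, relative to
    that piece, contains no such trace and hence is closed, so that the pieces
    are submaximal.  Finally a dense set contains the trace of an open set [U]
    on a piece [i].  For two dense sets with nowhere dense intersection and the
    same [i] the sets [U] are disjoint; as dense subspaces of the Cantor cube
    satisfy the countable chain condition, each [i] serves countably many dense
    sets, and there are at most [M * nat], that is [M], of them
    ([forced_not_extraresolvable]).

    The partitions come from an independent family of [2 ^ K] sets in the style
    of Hausdorff ([independent_family]) whose members are tagged by pairs
    [(A, a)], all pairs being used.  To close [A], the partitions
    tagged [(A, a)] are altered on [A] and at [a] so that they separate [a] from
    [A].  Closing every set would destroy the independence, so one takes, by
    Zorn's lemma, a maximal family [F] of sets whose simultaneous closing keeps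
    every box large on every piece.  No enumeration of the subsets of [K] is
    involved: for a set [A] outside [F], closing [A] on top of [F] makes some
    box small on some piece; the alteration is confined to [A] and finitely many
    points, so in the topology given by [F] itself the set [A] already contains
    that box on that piece, up to fewer than [K] points.  Sets of fewer than [K]
    points belong to [F], so the exceptional points form a closed set and can be
    avoided by shrinking the box.

    The cardinal arithmetic rests on [infinite_card_square], the equality of an
    infinite cardinal with its square. *)

(** * Squares of infinite cardinals *)

Lemma card_le_funP (K T : Type) (A : set T) :
  [set: K] #<= A <-> exists g : K -> T, (forall k, A (g k)) /\ injective g.
Proof.
split=> [/card_leP[f]|[g [gA g_inj]]].
  exists (fun k => val (f (SigSub (mem_set (I : [set: K] k))))); split.
    by move=> k; exact: set_valP.
  move=> k l /val_inj fkl.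
  have : SigSub (mem_set (I : [set: K] k)) = SigSub (mem_set (I : [set: K] l)).
    by apply: (@inj _ _ _ f) => //; rewrite inE.
  by move=> [].
apply: card_le_trans (subset_card_le (_ : range g `<=` A)).
  have /card_eqPle[] : range g #= [set: K] by apply: inj_card_eq => ? ? _ _; exact: g_inj.
  by [].
by move=> _ [k _ <-].
Qed.

Lemma card_le_typeP (T U : Type) :
  [set: T] #<= [set: U] <-> exists f : T -> U, injective f.
Proof. by rewrite card_le_funP; split=> [[f []]|[f]]; exists f. Qed.

(** A maximal partial injective matching of [A] with [B] exhausts one of them,
    since otherwise it could be enlarged by one pair. *)
Lemma card_comparable (T : Type) (A B : set T) :
  (exists f : T -> T, (forall a, A a -> B (f a)) /\ {in A &, injective f}) \/
  (exists f : T -> T, (forall b, B b -> A (f b)) /\ {in B &, injective f}).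
Proof.
pose P (G : set (T * T)) := forall p q, G p -> G q ->
  [/\ A p.1, B p.2 & p.1 = q.1 <-> p.2 = q.2].
have [F FP Fchain|G [PG Gmax]] := @Zorn_bigcup _ P.
  move=> p q [X FX Xp] [Y FY Yq].
  by have [XY|YX] := Fchain _ _ FX FY;
    [apply: (FP _ FY) => //; exact: XY | apply: (FP _ FX) => //; exact: YX].
have [domG|/existsNP[a]] := pselect (forall a, A a -> exists b, G (a, b)).
  left; have /choice[f fG] : forall a, exists b, A a -> G (a, b).
    by move=> a; have [/domG[b]|] := pselect (A a); [exists b|exists a].
  exists f; split=> [a /fG Ga|a b]; first by have [] := PG _ _ Ga Ga.
  rewrite !inE => /fG Ga /fG Gb fab.
  by have [_ _ [_ /(_ fab)]] := PG _ _ Ga Gb.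
move=> /not_implyP[Aa /forallNP aG].
have [ranG|/existsNP[b]] := pselect (forall b, B b -> exists a, G (a, b)).
  right; have /choice[f fG] : forall b, exists a, B b -> G (a, b).
    by move=> b; have [/ranG[c]|] := pselect (B b); [exists c|exists b].
  exists f; split=> [b' /fG Gb|b b']; first by have [] := PG _ _ Gb Gb.
  rewrite !inE => /fG Gb /fG Gb' fab.
  by have [_ _ [/(_ fab)]] := PG _ _ Gb Gb'.
move=> /not_implyP[Bb /forallNP bG].
exfalso; apply: (Gmax (G `|` [set (a, b)])).
  by split=> [|GS]; [exact: subsetUl|apply: (aG b); apply: GS; right].
move=> [x y] [x' y'] [Gp|[-> ->]] [Gq|[-> ->]] /=.
- exact: PG Gp Gq.
- have [Ax By _] := PG _ _ Gp Gp; split=> //; split=> [xa|yb].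
    by case: (aG y); rewrite -xa.
  by case: (bG x); rewrite -yb.
- split=> //; split=> [xa|yb].
    by case: (aG y'); rewrite xa.
  by case: (bG x'); rewrite yb.
- by [].
Qed.

Lemma infinite_set_two (T : Type) (A : set T) : infinite_set A ->
  exists x y, [/\ A x, A y & x <> y].
Proof.
move=> /infiniteP/card_le_funP[g [gA g_inj]].
by exists (g 0), (g 1); split=> // /g_inj.
Qed.

Section infinite_square.
Variable K : Type.
Hypothesis K_infinite : infinite_set [set: K].

(** An injection of [A * A] into [A], given by the values of a total function. *)
Let pairing_on (A : set K) (f : K * K -> K) :=
  (forall a b, A a -> A b -> A (f (a, b))) /\ {in A `*` A &, injective f}.

Let state := {Af : set K * (K * K -> K) |
  infinite_set Af.1 /\ pairing_on Af.1 Af.2}.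

Let extends (s t : state) : bool :=
  `[< (sval s).1 `<=` (sval t).1 /\
    forall a b, (sval s).1 a -> (sval s).1 b ->
      (sval s).2 (a, b) = (sval t).2 (a, b) >].

(* Zorn's lemma starts from a countable subset of [K]. *)
Let state0 : state.
Proof.
apply/cid; have /infiniteP/card_le_funP[o [_ o_inj]] := K_infinite.
have /card_eqPle[/card_le_typeP[c c_inj] _] := card_nat2.
have /choice[d dP] : forall k, exists n, range o k -> o n = k.
  by move=> k; have [[n _ <-]|?] := pselect (range o k); [exists n|exists 0].
exists (range o, fun p => o (c (d p.1, d p.2))) => /=; split.
  apply/infiniteP; rewrite card_le_funP; by exists o.
split=> [a b _ _|[a b] [a' b']]; first by exists (c (d a, d b)).
rewrite !inE => -[/= /dP ra /dP rb] [/= /dP ra' /dP rb'] /o_inj /c_inj [da db].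
by rewrite -ra -rb -ra' -rb' da db.
Qed.

Let chain_bound (F : set state) : total_on F extends ->
  exists t, forall s, F s -> extends s t.
Proof.
move=> Fchain; have [[s0 Fs0]|F0] := pselect (F !=set0); last first.
  by exists state0 => s Fs; case: F0; exists s.
pose U := \bigcup_(s in F) (sval s).1.
have /choice[f fE'] : forall p, exists c, forall s, F s ->
    (sval s).1 p.1 -> (sval s).1 p.2 -> c = (sval s).2 p.
  move=> [a b] /=; have [[s [Fs sa sb]]|none] := pselect
      (exists s, [/\ F s, (sval s).1 a & (sval s).1 b]); last first.
    by exists a => s Fs sa sb; case: none; exists s.
  exists ((sval s).2 (a, b)) => t Ft ta tb.
  by have [/asboolP[_ ->]|/asboolP[_ ->]] := Fchain _ _ Fs Ft.
have fE s a b : F s -> (sval s).1 a -> (sval s).1 b -> f (a, b) = (sval s).2 (a, b).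
  by move=> Fs sa sb; exact: fE'.
(* A chain is directed, so finitely many points lie in a common member. *)
have common a b : U a -> U b -> exists s, [/\ F s, (sval s).1 a & (sval s).1 b].
  move=> [s Fs sa] [t Ft tb]; have [/asboolP[st _]|/asboolP[ts _]] := Fchain _ _ Fs Ft.
    by exists t; split=> //; exact: st.
  by exists s; split=> //; exact: ts.
suff Uf : infinite_set U /\ pairing_on U f.
  exists (exist _ (U, f) Uf) => s Fs; apply/asboolP; split=> /=.
    by move=> a sa; exists s.
  by move=> a b sa sb; rewrite (fE s).
split.
  have [+ _] := svalP s0; apply: sub_infinite_set => a sa; by exists s0.
split=> [a b Ua Ub|].
  have [s [Fs sa sb]] := common _ _ Ua Ub; exists s => //.
  by rewrite (fE s) //; have [_ [+ _]] := svalP s; apply.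
move=> [a b] [a' b']; rewrite !inE => -[/= Ua Ub] [/= Ua' Ub'].
have [s [Fs sa sb]] := common _ _ Ua Ub.
have [s' [Fs' sa' sb']] := common _ _ Ua' Ub'.
have [t [Ft [ta tb ta' tb']]] : exists t, F t /\
    [/\ (sval t).1 a, (sval t).1 b, (sval t).1 a' & (sval t).1 b'].
  have [/asboolP[st _]|/asboolP[ts _]] := Fchain _ _ Fs Fs'.
    by exists s'; split=> //; split=> //; exact: st.
  by exists s; split=> //; split=> //; exact: ts.
rewrite !(fE t) // => ff; have [_ [_ tinj]] := svalP t.
by apply: tinj => //; rewrite inE.
Qed.

(** Take a maximal infinite [A] with an injection of [A * A] into [A].  If the
    complement of [A] embeds in [A], then so does [K], two points of [A] serving
    as labels for the two halves, and the pairing of [A] transfers to [K].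
    Otherwise the complement contains a copy of [A], and the pairing extends to
    the union of [A] and this copy, with the new pairs sent into the copy; this
    contradicts maximality. *)
Theorem infinite_card_square : [set: K * K] #<= [set: K].
Proof.
have extends_refl s : extends s s by apply/asboolP; split.
have extends_trans r s t : extends r s -> extends s t -> extends r t.
  move=> /asboolP[rs rsE] /asboolP[st stE]; apply/asboolP; split.
    exact: subset_trans st.
  by move=> a b ra rb; rewrite rsE // stE //; exact: rs.
have [[[A f] /= [Ainf [fA f_inj]]] Amax] :=
  ZL_preorder state0 extends_refl extends_trans chain_bound.
have f_injA a b a' b' : A a -> A b -> A a' -> A b' ->
    f (a, b) = f (a', b') -> a = a' /\ b = b'.
  move=> Aa Ab Aa' Ab' ff.
  by have [] : (a, b) = (a', b') by apply: (f_inj); rewrite ?inE.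
have [p0 [p1 [Ap0 Ap1 p01]]] := infinite_set_two Ainf.
have [[h [hA h_inj]]|[h [hA h_inj]]] := card_comparable (~` A) A.
  (* The labels [p0] and [p1] make [e] injective across the two halves. *)
  pose e k := if pselect (A k) then f (p0, k) else f (p1, h k).
  have eA k : A (e k).
    by rewrite /e; case: pselect => Ak; apply: (fA) => //; exact: hA.
  have e_inj : injective e.
    move=> k l; rewrite /e.
    case: pselect => Ak; case: pselect => Al /f_injA[] //; try exact: hA.
    - by move=> /esym.
    - by move=> _ /h_inj; apply; rewrite inE.
  apply/card_le_typeP; exists (fun p => f (e p.1, e p.2)).
  by move=> [a b] [a' b'] /= /f_injA[] // /e_inj -> /e_inj ->.
(* Points of [A] and of its copy are told apart by [tag], and located by [r]. *)
have /choice[g gP] : forall k, exists a, (h @` A) k -> A a /\ h a = k.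
  by move=> k; have [[a Aa <-]|?] := pselect ((h @` A) k); [exists a|exists k].
pose r k := if pselect (A k) then k else g k.
pose tag k := if pselect (A k) then p0 else p1.
pose A' := A `|` h @` A.
have rA k : A' k -> A (r k).
  by rewrite /r; case: pselect => // Ak [//|/gP[]].
have tagA k : A (tag k) by rewrite /tag; case: pselect.
have rtag_inj k l : A' k -> A' l -> tag k = tag l -> r k = r l -> k = l.
  rewrite /tag /r; case: pselect => Ak; case: pselect => Al //.
  - by move=> _ _ /esym.
  - by move=> [//|/gP[_ gk]] [//|/gP[_ gl]] _ /= gkl; rewrite -gk -gl gkl.
pose f' p := if pselect (A p.1 /\ A p.2) then f p
  else h (f (f (tag p.1, tag p.2), f (r p.1, r p.2))).
have f'_in p : A p.1 -> A p.2 -> f' p = f p.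
  by rewrite /f' => A1 A2; case: pselect => // -[].
have ext : infinite_set A' /\ pairing_on A' f'.
  split; first by apply: (sub_infinite_set _ Ainf); exact: subsetUl.
  split=> [a b|[a b] [a' b']].
    move=> A'a A'b; rewrite /f'; case: pselect => [[/= Aa Ab]|_] /=.
      by left; exact: (fA).
    right; exists (f (f (tag a, tag b), f (r a, r b))) => //.
    by apply: (fA); apply: (fA) => //; exact: rA.
  rewrite !inE => -[/= A'a A'b] [/= A'a' A'b']; rewrite /f' /=.
  have codeA x y : A' x -> A' y -> A (f (f (tag x, tag y), f (r x, r y))).
    by move=> A'x A'y; apply: (fA); apply: (fA) => //; exact: rA.
  case: pselect => [[Aa Ab]|nab]; case: pselect => [[Aa' Ab']|nab'].
  - by move=> /f_injA[] // -> ->.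
  - move=> /= E; case: (hA (f (f (tag a', tag b'), f (r a', r b')))).
      exact: codeA.
    by rewrite -E; exact: (fA).
  - move=> /= E; case: (hA (f (f (tag a, tag b), f (r a, r b)))).
      exact: codeA.
    by rewrite E; exact: (fA).
  move=> /h_inj; rewrite !inE => /(_ (codeA _ _ A'a A'b) (codeA _ _ A'a' A'b')).
  move=> /f_injA[] //; try by apply: (fA) => //; exact: rA.
  move=> /f_injA[] // ta tb /f_injA[]; try exact: rA.
  by move=> ra rb; congr pair; exact: rtag_inj.
have /asboolP[A'A _] : extends (exist _ (A', f') ext)
    (exist _ (A, f) (conj Ainf (conj fA f_inj))).
  by apply: Amax; apply/asboolP; split=> [|a b Aa Ab] /=;
    [exact: subsetUl|rewrite f'_in].
by case: (hA p0) => //; apply: A'A; right; exists p0.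
Qed.

End infinite_square.

(** * Arithmetic with an infinite cardinal *)

Section infinite_cardinals.
Variable K : Type.
Hypothesis K_infinite : infinite_set [set: K].

Lemma infinite_card_prod (T U : Type) :
  [set: T] #<= [set: K] -> [set: U] #<= [set: K] -> [set: T * U] #<= [set: K].
Proof.
move=> /card_le_typeP[f f_inj] /card_le_typeP[g g_inj].
apply: card_le_trans (infinite_card_square K_infinite).
apply/card_le_typeP; exists (fun p => (f p.1, g p.2)).
by move=> [a b] [a' b'] /= [/f_inj -> /g_inj ->].
Qed.

Lemma infinite_card_countable (T : Type) :
  countable [set: T] -> [set: T] #<= [set: K].
Proof. by move=> /card_le_trans; apply; apply/infiniteP. Qed.

Lemma infinite_card_seq (T : Type) :
  [set: T] #<= [set: K] -> [set: seq T] #<= [set: K].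
Proof.
move=> /card_le_typeP[f f_inj].
have /card_le_typeP[p p_inj] := infinite_card_square K_infinite.
have /infiniteP/card_le_typeP[o o_inj] := K_infinite.
pose code := foldr (fun t k => p (f t, k)) (o 0).
suff code_inj s t : size s = size t -> code s = code t -> s = t.
  apply/card_le_typeP; exists (fun s => p (o (size s), code s)).
  by move=> s t /p_inj [/o_inj + +]; exact: code_inj.
elim: s t => [|x s IH] [|y t] //= [st] /p_inj[/f_inj -> E].
by rewrite (IH t).
Qed.

(** A set of size [K * K] covered by [A] and [B] has a row inside [B], or every
    row meets [A]; this avoids comparing [A] with [B]. *)
Lemma card_le_setU (T : Type) (A B : set T) :
  [set: K] #<= A `|` B -> [set: K] #<= A \/ [set: K] #<= B.
Proof.
move=> /card_le_funP[g [gAB g_inj]].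
have /card_le_typeP[p p_inj] := infinite_card_square K_infinite.
have [[k kB]|rows] := pselect (exists k, forall l, B (g (p (k, l)))).
  right; apply/card_le_funP; exists (fun l => g (p (k, l))); split=> //.
  by move=> l l' /g_inj /p_inj [].
left; have /choice[l lA] : forall k, exists l, A (g (p (k, l))).
  move=> k; apply: contrapT => kA; apply: rows; exists k => l.
  by case: (gAB (p (k, l))) => // Agl; case: kA; exists l.
apply/card_le_funP; exists (fun k => g (p (k, l k))); split=> //.
by move=> k k' /g_inj /p_inj [].
Qed.

Lemma infinite_not_card_le_finite (T : Type) (A : set T) :
  finite_set A -> ~ ([set: K] #<= A).
Proof. by move=> Afin KA; apply: K_infinite; exact: card_le_finite KA Afin. Qed.

End infinite_cardinals.

(** * Independent families of partitions *)

Definition box (I : eqType) (J : Type) (x : I -> J -> bool) (js : seq I)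
  (e : I -> bool) : set J := [set k | {in js, forall j, x j k = e j}].

(** A pattern [e] on a finite list of indices prescribes one side of each of the
    corresponding partitions. *)
Definition independent_on (I : eqType) (J M : Type) (piece : J -> M) (K : Type)
    (x : I -> J -> bool) : Prop :=
  forall i js e, [set: K] #<= piece @^-1` [set i] `&` box x js e.

(** The points of a piece code propositional formulas in disjunctive normal form
    with variables in [K], and the coordinate [Y : set K] evaluates formulas
    under the assignment [Y].  Finitely many distinct assignments can be given
    arbitrary values by a formula; a third component of the code, ranging over
    [K], repeats each formula [K] times. *)
Lemma independent_family (M K : Type) (i0 : M) :
  infinite_set [set: K] -> [set: M] #<= [set: K] ->
  exists (piece : K -> M) (x : set K -> K -> bool),
    independent_on piece K x.
Proof.
(* The membership predicates on lists of literals need equality tests on [K]. *)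
elim/Peq: K => K K_infinite MK.
have boolK : [set: bool] #<= [set: K].
  exact: infinite_card_countable.
have K_le : [set: K] #<= [set: K] by [].
have := infinite_card_prod K_infinite (infinite_card_prod K_infinite MK K_le)
  (infinite_card_seq K_infinite (infinite_card_seq K_infinite
    (infinite_card_prod K_infinite K_le boolK))).
move=> /card_le_typeP[code code_inj].
have /choice[decode codeK] : forall k, exists p, range code k -> code p = k.
  move=> k; have [[p _ <-]|?] := pselect (range code k); first by exists p.
  by exists ((i0, k), [::]).
have {codeK} codeK : cancel code decode.
  by move=> p; apply: code_inj; apply: codeK; exists p.
pose sat (Y : set K) (c : seq (K * bool)) := all (fun l => `[< Y l.1 >] == l.2) c.
pose x (Y : set K) k := has (sat Y) (decode k).2.
exists (fun k => (decode k).1.1), x => i js e.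
have [w wP] : exists w : set K -> set K -> K, forall Y Z, Y <> Z ->
    `[< Y (w Y Z) >] <> `[< Z (w Y Z) >].
  have /infinite_setN0[k0 _] := K_infinite.
  suff /choice[w wP] : forall YZ : set K * set K, exists k, YZ.1 <> YZ.2 ->
      `[< YZ.1 k >] <> `[< YZ.2 k >].
    by exists (fun Y Z => w (Y, Z)) => Y Z /(wP (Y, Z)).
  move=> [Y Z] /=; have [->|YZ] := pselect (Y = Z); first by exists k0.
  apply: contrapT => /forallNP same; apply: YZ; apply/funext => k.
  apply/propext; apply: asbool_eq_equiv; apply: contrapT => Yk.
  by apply: (same k).
(* Among the assignments in [js], the clause of [Y] holds at [Y] only. *)
pose clause Y := [seq (w Y Z, `[< Y (w Y Z) >]) | Z <- js & Z != Y].
pose t := [seq clause Y | Y <- js & e Y].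
have tE : {in js, forall Y, has (sat Y) t = e Y}.
  move=> Y Yjs; apply/idP/idP => [/hasP[_ /mapP[Z + ->] satYZ]|eY].
    rewrite mem_filter => /andP[eZ Zjs]; have [->//|YZ] := eqVneq Y Z.
    move/allP: satYZ => /(_ (w Z Y, `[< Z (w Z Y) >])) /=.
    rewrite map_f ?mem_filter ?YZ // => /(_ isT) /eqP E.
    by move/eqP: YZ => /nesym /wP; rewrite E.
  apply/hasP; exists (clause Y); first by apply: map_f; rewrite mem_filter eY.
  by apply/allP => _ /mapP[Z _ ->] /=.
apply/card_le_funP; exists (fun k => code ((i, k), t)); split=> [k|k l].
  by split=> [|Y Yjs]; rewrite /x /= codeK //=; exact: tE.
by move=> /code_inj [].
Qed.

(** Closedness of [A] is witnessed here by single coordinates: each point outside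
    [A] has a coordinate separating it from all of [A]. *)
Definition forces (I : eqType) (J M : Type) (piece : J -> M)
    (x : I -> J -> bool) : Prop :=
  forall A : set J,
    (exists i js e, piece @^-1` [set i] `&` box x js e !=set0 /\
       piece @^-1` [set i] `&` box x js e `<=` A) \/
    forall k, ~ A k -> exists j, x j k /\ forall a, A a -> ~~ x j a.

(** A coordinate tagged [(A, a)] with [A] in [F] is set to false on [A] and to
    true at [a], all other values being kept.  Being large is a condition on
    finitely many coordinates, so the families [F] whose alteration preserves
    independence are closed under unions of chains, and there is a maximal one.
    For its alteration, the sets in [F] are closed, and maximality provides the
    box for each of the other sets. *)
Theorem maximal_closing (M K : Type) (I : eqType) (piece : K -> M)
    (x : I -> K -> bool) (tag : I -> set K * K) :
  infinite_set [set: K] -> (forall p, exists j, tag j = p) ->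
  independent_on piece K x ->
  exists y : I -> K -> bool, independent_on piece K y /\ forces piece y.
Proof.
move=> K_infinite tag_surj x_indep.
pose y (F : set (set K)) j k := if `[< F (tag j).1 >] then
  if `[< (tag j).1 k >] then false
  else if `[< (tag j).2 = k >] then true else x j k else x j k.
have [G Gchain Gtot|F [Findep Fmax]] :=
    @Zorn_bigcup _ [set F | independent_on piece K (y F)].
  move=> i js e; suff [F Findep yE] : exists2 F, independent_on piece K (y F) &
      {in js, forall j, y (\bigcup_(X in G) X) j = y F j}.
    apply: card_le_trans (Findep i js e) (subset_card_le _).
    by move=> k [ki kbox]; split=> // j jjs; rewrite yE // kbox.
  (* One member of the chain agrees with the union on the tags of [js]. *)
  have [->|/set0P[F0 GF0]] := eqVneq G set0.
    exists set0; last by rewrite bigcup_set0.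
    have -> : y set0 = x by apply/funext => j; apply/funext => k; rewrite /y asboolF.
    by [].
  have [F GF FE] : exists2 F, G F & {in js, forall j,
      (\bigcup_(X in G) X) (tag j).1 -> F (tag j).1}.
    elim: js => [|j js [F GF FE]]; first by exists F0.
    have [[X GX Xj]|nj] := pselect ((\bigcup_(X in G) X) (tag j).1).
      have [XF|FX] := Gtot _ _ GX GF.
        exists F => // j'; rewrite inE => /predU1P[->|/FE] //; by move=> _; exact: XF.
      exists X => // j'; rewrite inE => /predU1P[->//|/FE j'F /j'F]; exact: FX.
    by exists F => // j'; rewrite inE => /predU1P[->|/FE].
  exists F; first exact: Gchain.
  move=> j jjs; apply/funext => k; rewrite /y.
  suff -> : `[< (\bigcup_(X in G) X) (tag j).1 >] = `[< F (tag j).1 >] by [].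
  by apply: asbool_equiv_eq; split=> [/FE|Fj]; [exact|exists F].
have F_closes A : F A -> forall k, ~ A k ->
    exists j, y F j k /\ forall a, A a -> ~~ y F j a.
  move=> FA k Ak; have [j jE] := tag_surj (A, k); exists j.
  rewrite /y jE /= (asboolT FA) (asboolF Ak) asboolT //; split=> // a Aa.
  by rewrite asboolT.
(* Outside [A] and the points [pts] tagged in [js], closing [A] on top of [F]
   changes no coordinate in [js]. *)
have F_out A : ~ F A -> exists i js e,
    ~ ([set: K] #<= (piece @^-1` [set i] `&` box (y F) js e) `\` A).
  move=> FA; have : ~ independent_on piece K (y (F `|` [set A])).
    apply: Fmax; split=> [|FAF]; first exact: subsetUl.
    by apply: FA; apply: FAF; right.
  move=> /existsNP[i /existsNP[js /existsNP[e small]]]; exists i, js, e.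
  move: small; apply: contra_not => large.
  pose pts := (fun j => (tag j).2) @` [set` js].
  have pts_finite : finite_set pts by apply: finite_image; exact: finite_seq.
  have [//|] : [set: K] #<=
      (piece @^-1` [set i] `&` box (y (F `|` [set A])) js e) \/ [set: K] #<= pts.
    apply: card_le_setU => //; apply: card_le_trans large (subset_card_le _).
    move=> k [[ki kbox] Ak]; have [kpts|kpts] := pselect (pts k); first by right.
    left; split=> // j jjs; rewrite -kbox // /y.
    have /asboolF -> : (tag j).2 <> k by move=> jk; apply: kpts; exists j.
    have [->|jA] := pselect ((tag j).1 = A).
      by rewrite (asboolF Ak) !if_same.
    suff -> : `[< (F `|` [set A]) (tag j).1 >] = `[< F (tag j).1 >] by [].
    by apply: asbool_equiv_eq; split=> [[]|]; [| |left].
  by move=> /(infinite_not_card_le_finite K_infinite pts_finite).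
exists (y F); split=> // A.
have [FA|FA] := pselect (F A); [right; exact: F_closes|left].
have [i [js [e small]]] := F_out A FA.
pose R := (piece @^-1` [set i] `&` box (y F) js e) `\` A.
(* The exceptional set [R] is small, so removing it leaves every box large. *)
have FR : F R.
  apply: contrapT => /F_out[i' [js' [e']]]; apply.
  have : [set: K] #<= (piece @^-1` [set i'] `&` box (y F) js' e') `\` R `|` R.
    apply: card_le_trans (Findep i' js' e') (subset_card_le _) => k kbox.
    by have [Rk|Rk] := pselect (R k); [right|left].
  by move=> /(card_le_setU K_infinite)[|/small].
have [s [sbox Rs]] :
    exists s, (piece @^-1` [set i] `&` box (y F) js e) s /\ ~ R s.
  apply: contrapT => /forallNP sR; apply: small.
  apply: card_le_trans (Findep i js e) (subset_card_le _) => k kbox.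
  by apply: contrapT => Rk; apply: (sR k).
(* The coordinate [j] separates the point [s] of the box from [R]. *)
have [j [yjs yjR]] := F_closes R FR s Rs.
exists i, (j :: js), (y F ^~ s); split.
  by exists s; split=> //; case: sbox.
case: sbox => _ sbox k [ki kbox]; apply: contrapT => Ak.
have : ~~ y F j k.
  apply: yjR; split=> //; split=> // j' j'js.
  by rewrite -sbox // kbox // inE j'js orbT.
by rewrite kbox ?yjs // inE eqxx.
Qed.

(** A subset of [K] codes, through an injection of two copies of [K] into [K], a
    subset and a singleton. *)
Lemma tagging_surjective (K : Type) : infinite_set [set: K] ->
  exists tag : set K -> set K * K, forall p, exists Y, tag Y = p.
Proof.
move=> K_infinite; have [k0 _] := infinite_setN0 K_infinite.
have : [set: bool * K] #<= [set: K].
  by apply: infinite_card_prod => //; exact: infinite_card_countable.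
move=> /card_le_typeP[c c_inj].
have /choice[get getP] : forall Z : set K, exists k, Z !=set0 -> Z k.
  by move=> Z; have [[k Zk]|?] := pselect (Z !=set0); [exists k|exists k0].
exists (fun Y => ([set k | Y (c (true, k))], get [set k | Y (c (false, k))])).
move=> [A k]; exists [set l | (exists2 a, A a & l = c (true, a)) \/ l = c (false, k)].
congr pair.
  apply/seteqP; split=> [a [[a' Aa' /c_inj [->//]]|/c_inj//]|a Aa] /=.
  by left; exists a.
set Z := [set k | _]; have /getP : Z !=set0 by exists k; right.
by move=> [[a _ /c_inj//]|/c_inj []].
Qed.

(** * The countable chain condition *)

(** The indexed form allows choosing smaller open sets without changing [P]. *)
Definition ccc (T : topologicalType) : Prop :=
  forall (L : Type) (P : set L) (U : L -> set T),
    (forall l, P l -> open (U l) /\ U l !=set0) -> trivIset P U -> countable P.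

Section cantor_cube_basis.
Variable I : choiceType.

Definition cylinder (js : seq I) (e : I -> bool) : set (cantor_cube I) :=
  box (fun j (z : cantor_cube I) => z j) js e.

Lemma cylinder_open js e : open (cylinder js e).
Proof.
elim: js => [|j js IH].
  by rewrite (_ : cylinder _ _ = setT) ?predeqE //; exact: openT.
have -> : cylinder (j :: js) e =
    proj j @^-1` [set e j] `&` cylinder js e.
  apply/seteqP; split=> [z zb|z [zj zb] j'].
    by split=> [|j' j'js]; apply: zb; rewrite inE ?eqxx ?j'js ?orbT.
  by rewrite inE => /predU1P[->|/zb].
apply: openI => //; apply: open_comp; last exact: discrete_open.
by move=> z _; exact: (@proj_continuous I (fun=> bool)).
Qed.

(** The cylinders around [z] generate a filter that converges to [z] in every
    coordinate, hence in the cube. *)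
Lemma open_cylinder (U : set (cantor_cube I)) (z : cantor_cube I) :
  open U -> U z -> exists js, cylinder js z `<=` U.
Proof.
move=> oU Uz; pose F : set_system (cantor_cube I) :=
  filter_from setT (fun js : seq I => cylinder js z).
have FF : Filter F.
  apply: filter_from_filter; first by exists [::].
  move=> s t _ _; exists (s ++ t) => // w wb; split=> j jin; apply: wb;
    by rewrite mem_cat jin ?orbT.
suff : F --> z by move=> /(_ U (open_nbhs_nbhs (conj oU Uz))) [js _]; exists js.
apply/cvg_sup => i A [B [[C oC <-] Cz] BA]; exists [:: i] => // w wb.
by apply: BA; rewrite /= wb ?inE.
Qed.

(** Pairwise incompatible finite partial functions with domains of bounded size
    are finite in number: all of them but one, [l], disagree with [l] at some
    [j] in its domain.  Those which disagree with [l] at a given [j] agree with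
    each other there, so that [j] can be dropped from their domains while they
    remain incompatible. *)
Lemma conflict_finite n (L : Type) (P : set L) (s : L -> seq I)
    (e : L -> I -> bool) :
  (forall l, P l -> size (s l) <= n) ->
  (forall l m, P l -> P m -> l <> m ->
    exists j, [/\ j \in s l, j \in s m & e l j <> e m j]) ->
  finite_set P.
Proof.
elim: n => [|n IH] in P s * => sn conf.
  have [->|/set0P[l Pl]] := eqVneq P set0; first exact: finite_set0.
  apply: sub_finite_set (finite_set1 l) => m Pm; apply: contrapT => ml.
  by have [j [+ _ _]] := conf _ _ Pm Pl ml; have := sn m Pm; case: (s m).
have [->|/set0P[l Pl]] := eqVneq P set0; first exact: finite_set0.
pose Q j := [set m | [/\ P m, j \in s m & e l j <> e m j]].
have : finite_set ([set l] `|` \bigcup_(j in [set` s l]) Q j).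
  rewrite finite_setU; split; first exact: finite_set1.
  apply: bigcup_finite; first exact: finite_seq.
  move=> j _; apply: (IH (Q j) (fun m => [seq i <- s m | i != j])).
    move=> m [Pm jm _]; rewrite size_filter -ltnS.
    apply: leq_trans (sn m Pm); rewrite -(count_predC (fun i => i != j) (s m)).
    rewrite -[X in X < _]addn0 ltn_add2l -has_count; apply/hasP; exists j => //=.
    by rewrite eqxx.
  move=> m m' [Pm _ em] [Pm' _ em'] mm'.
  have [i [im im' ei]] := conf _ _ Pm Pm' mm'; exists i.
  have ij : i != j.
    by apply/eqP => ij; apply: ei; move: em em'; rewrite ij; do 3!case: (e _ j).
  by rewrite !mem_filter ij.
apply: sub_finite_set => m Pm; have [->|ml] := pselect (m = l); first by left.
have [j [jl jm ej]] := conf _ _ Pl Pm (nesym ml).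
by right; exists j.
Qed.

(** Disjoint cylinders are given by incompatible partial functions. *)
Theorem cantor_cube_ccc : ccc (cantor_cube I).
Proof.
move=> L P U oU trivU.
have /choice[js_e jsP] : forall l, exists js_e, P l ->
    cylinder js_e.1 js_e.2 `<=` U l.
  move=> l; have [/oU[oUl [z Ulz]]|nPl] := pselect (P l); last first.
    by exists ([::], fun=> true).
  by have [js jsU] := open_cylinder oUl Ulz; exists (js, z).
have -> : P = \bigcup_n [set l | P l /\ size (js_e l).1 <= n].
  by apply/seteqP; split=> [l Pl|l [n _ []]//]; exists (size (js_e l).1).
apply: bigcup_countable => // n _; apply: finite_set_countable.
apply: (@conflict_finite n _ _ (fun l => (js_e l).1) (fun l => (js_e l).2)).
  by move=> l [].
move=> l m [Pl _] [Pm _] lm; apply: contrapT => /forallNP compat.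
apply: lm; apply: trivU => //.
(* Compatible partial functions have a common extension. *)
exists (fun j => if j \in (js_e l).1 then (js_e l).2 j else (js_e m).2 j).
split; [apply: (jsP l Pl)|apply: (jsP m Pm)] => j js; rewrite ?js //.
case: ifP => // jl; apply: contrapT => E; apply: (compat j); split=> //.
Qed.

End cantor_cube_basis.

(** Open sets of the ambient space whose traces on [X] are disjoint are disjoint
    themselves, because a nonempty open set meets [X]. *)
Lemma dense_ccc (T : topologicalType) (X : set T) :
  ccc T -> dense X -> ccc (set_type X).
Proof.
move=> cccT dX L P U oU trivU.
have /choice[V VP] : forall l, exists V, P l -> open V /\ U l = set_val @^-1` V.
  move=> l; have [/oU[[V oV <-] _]|nPl] := pselect (P l); last by exists setT.
  by exists V.
apply: (cccT L P V) => [l Pl|l m Pl Pm [z [Vl Vm]]].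
  have [oV UV] := VP l Pl; split=> //.
  by have [_ [z]] := oU l Pl; rewrite UV; exists (val z).
have [oVl UVl] := VP l Pl; have [oVm UVm] := VP m Pm.
have [x [[Vlx Vmx] Xx]] : (V l `&` V m) `&` X !=set0.
  by apply: dX; [exists z|exact: openI].
apply: trivU => //; exists (SigSub (mem_set Xx)).
by rewrite UVl UVm.
Qed.

Lemma resolvable_extraresolvable (T : topologicalType) (L : Type) :
  resolvable T L -> extraresolvable T L.
Proof.
move=> [D [DL Ddense Dtriv]]; exists D; split=> // A B DA DB AB.
have -> : A `&` B = set0.
  by apply: contrapT => /eqP/set0P AB0; apply: AB; exact: (Dtriv A B).
by rewrite /nowhere_dense closure0 interior0.
Qed.

(** * Spaces in which every set is closed or contains part of a piece *)

Section forced_pieces.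
Variables (T : topologicalType) (M K : Type) (piece : T -> M) (i0 : M).
Hypothesis K_infinite : infinite_set [set: K].
Hypothesis piece_large : forall i (U : set T), open U -> U !=set0 ->
  [set: K] #<= piece @^-1` [set i] `&` U.
Hypothesis forced : forall A : set T, closed A \/
  exists i U, [/\ open U, U !=set0 & piece @^-1` [set i] `&` U `<=` A].

Lemma piece_dense i : dense (piece @^-1` [set i]).
Proof.
move=> U U0 oU; have /card_le_funP[g [gU _]] := piece_large i oU U0.
by have [k _] := infinite_setN0 K_infinite; exists (g k); rewrite setIC.
Qed.

Lemma piece_somewhere_dense i (U A : set T) : open U -> U !=set0 ->
  piece @^-1` [set i] `&` U `<=` A -> ~ nowhere_dense A.
Proof.
move=> oU [u Uu] UA A0; suff : interior (closure A) u by rewrite A0.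
rewrite /interior nbhsE; exists U => // v Uv V.
rewrite nbhsE => -[W [oW Wv] WV].
have [w [[Ww Uw] iw]] : (W `&` U) `&` piece @^-1` [set i] !=set0.
  by apply: piece_dense; [exists v|exact: openI].
by exists w; split; [exact: UA|exact: WV].
Qed.

Lemma forced_nodec : nodec T.
Proof.
move=> A A0; have [//|[i [U [oU U0 UA]]]] := forced A.
by case: (piece_somewhere_dense oU U0 UA).
Qed.

Lemma open_large (U : set T) : open U -> U !=set0 -> [set: K] #<= U.
Proof.
by move=> oU U0; apply: card_le_trans (piece_large i0 oU U0) (subset_card_le _).
Qed.

Lemma somewhere_dense_large (A : set T) : ~ nowhere_dense A -> [set: K] #<= A.
Proof.
move=> A0; have [cA|[i [U [oU U0 UA]]]] := forced A; last first.
  exact: card_le_trans (piece_large i oU U0) (subset_card_le UA).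
have intA0 : interior A !=set0.
  apply/set0P/eqP => A0'; apply: A0.
  by rewrite /nowhere_dense -(closure_id A).1.
apply: card_le_trans (open_large (open_interior A) intA0) (subset_card_le _).
exact: interior_subset.
Qed.

Lemma forced_nonempty : [set: T] #= [set: K] -> [set: T] !=set0.
Proof.
move=> /card_eqPle[_ /card_le_funP[g _]].
by have [k _] := infinite_setN0 K_infinite; exists (g k).
Qed.

Lemma forced_nwd : [set: T] #= [set: K] -> is_nwd T K.
Proof.
move=> TK; split; last exact: somewhere_dense_large.
exists setT => //; apply: (@piece_somewhere_dense i0 setT) => //.
- exact: openT.
- exact: forced_nonempty.
Qed.

Lemma forced_Delta : [set: T] #= [set: K] -> is_Delta T K.
Proof.
move=> TK; split; last by move=> U [oU U0]; exact: open_large.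
by exists setT => //; split; [exact: openT|exact: forced_nonempty].
Qed.

(** The complement [N] of a dense subset of the piece [i], relative to this piece,
    cannot contain a trace [U] of a piece: this piece would be [i], and the dense
    subset meets [U].  Hence [N] is closed. *)
Lemma piece_submaximal i : submaximal (set_type (piece @^-1` [set i])).
Proof.
move=> A dA; pose N := piece @^-1` [set i] `\` set_val @` A.
have cN : closed N.
  have [//|[j [U [oU U0 UN]]]] := forced N.
  have [u [Uu ju]] := piece_dense j U0 oU.
  have ij : j = i by have [+ _] := UN u (conj ju Uu); rewrite /= ju.
  have [a [Ua Aa]] : set_val @^-1` U `&` A !=set0.
    apply: dA; last by exists U.
    have iu : u \in piece @^-1` [set i] by rewrite inE -ij.
    by exists (SigSub iu).
  have [_ []] : N (val a); last by exists a.
  by apply: UN; split=> //; have := set_valP a; rewrite /= ij.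
exists (~` N); first exact: closed_openC.
apply/seteqP; split=> [a|a Aa].
  move=> /= Na; have [[b Ab /val_inj <-//]|nAa] := pselect ((set_val @` A) (val a)).
  by case: Na; split=> //; exact: set_valP.
by move=> [_ []]; exists a.
Qed.

Lemma forced_disjoint_union : [set: T] #= [set: K] ->
  disjoint_union_of_dense_submaximal T M.
Proof.
move=> TK; exists (range (fun i => piece @^-1` [set i])); split.
- apply: inj_card_eq => i j _ _ ij.
  have [u [_ ju]] := piece_dense i (forced_nonempty TK) openT.
  by have : (piece @^-1` [set i]) u by []; rewrite ij /= => <-; rewrite ju.
- by move=> _ _ [i _ <-] [j _ <-] [u [/= -> ->]].
- apply/seteqP; split=> // u _.
  by exists (piece @^-1` [set piece u]).
by move=> _ [i _ <-]; split; [exact: piece_dense|exact: piece_submaximal].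
Qed.

Lemma forced_resolvable : [set: T] #= [set: K] -> resolvable T M.
Proof.
move=> /forced_disjoint_union[D [DM Dtriv _ Dsub]]; exists D; split=> // A DA.
by have [] := Dsub A DA.
Qed.

(** Each dense set [A] is assigned a piece [i] and an open set whose trace on [i]
    it contains.  The open sets of those [A] which are assigned the same [i] are
    disjoint, so that they are countably many by the chain condition. *)
Lemma forced_not_extraresolvable (L : Type) : [set: T] #= [set: K] ->
  ccc T -> infinite_set [set: M] ->
  card_lt [set: M] [set: L] -> ~ extraresolvable T L.
Proof.
move=> TK cccT M_infinite [_ LM] [D [DL Ddense Dnwd]]; apply: LM.
have /choice[iU iUP] : forall A, exists iU, D A ->
    [/\ open iU.2, iU.2 !=set0 & piece @^-1` [set iU.1] `&` iU.2 `<=` A].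
  move=> A; have [DA|nDA] := pselect (D A); last by exists (i0, setT).
  have [cA|[i [U UA]]] := forced A; last by exists (i, U).
  (* A dense closed set is the whole space. *)
  exists (i0, setT) => _; split; [exact: openT|exact: forced_nonempty|].
  move=> u _; rewrite (closure_id A).1 // => V; rewrite nbhsE => -[W [oW Wu] WV].
  have [w [Ww Aw]] := Ddense A DA W (ex_intro _ u Wu) oW.
  by exists w; split=> //; exact: WV.
pose Dn i := D `&` [set A | (iU A).1 = i].
have /choice[f f_inj] : forall i, exists f : set T -> nat,
    {in Dn i &, injective f}.
  move=> i; apply/countable_injP; apply: (cccT _ _ (fun A => (iU A).2)).
    by move=> A [DA _]; have [] := iUP A DA.
  move=> A B [DA iA] [DB iB] AB0; apply: contrapT => AB.
  have [oA _ subA] := iUP A DA; have [oB _ subB] := iUP B DB.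
  apply: (@piece_somewhere_dense i _ _ (openI oA oB) AB0) (Dnwd A B DA DB AB).
  by move=> u [iu [Au Bu]]; split; [apply: subA|apply: subB]; rewrite ?iA ?iB.
have MNM : [set: M * nat] #<= [set: M].
  by apply: infinite_card_prod => //; exact: infinite_card_countable.
apply: card_le_trans MNM.
have /card_eqPle[_ /card_le_funP[g [gD g_inj]]] := DL.
apply/card_le_typeP; exists (fun l => ((iU (g l)).1, f (iU (g l)).1 (g l))).
move=> l m [ilm]; rewrite -ilm => /f_inj E; apply: g_inj; apply: E; rewrite inE;
  by split.
Qed.

Lemma forced_not_maximally_resolvable : [set: T] #= [set: K] ->
  ccc T -> infinite_set [set: M] -> card_lt [set: M] [set: K] ->
  ~ maximally_resolvable T.
Proof.
move=> TK cccT M_infinite [MK KM] [L [[U [oU U0] UL] _]].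
move=> /resolvable_extraresolvable.
have KL : [set: K] #<= [set: L].
  by apply: card_le_trans (open_large oU U0) _; have /card_eqPle[] := UL.
apply: forced_not_extraresolvable => //; split; first exact: card_le_trans MK KL.
by move=> LM; apply: KM; exact: card_le_trans KL LM.
Qed.

End forced_pieces.

(** * The subspace of the Cantor cube given by a family of partitions *)

Section evaluation.
Variables (M K : Type) (i0 : M) (piece : K -> M) (y : set K -> K -> bool).
Hypothesis K_infinite : infinite_set [set: K].
Hypothesis y_indep : independent_on piece K y.
Hypothesis y_forces : forces piece y.

Definition eval (k : K) : cantor_cube (set K) := fun j => y j k.

(** Singletons are too small to contain a box on a piece, so a coordinate
    separates [k] from [l]. *)
Lemma eval_inj : injective eval.
Proof.
move=> k l kl; apply: contrapT => k_l.
have [[i [js [e [_ sub]]]]|/(_ k k_l)[j [jk /(_ l erefl)]]] := y_forces [set l].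
  apply: (infinite_not_card_le_finite K_infinite (finite_set1 l)).
  exact: card_le_trans (y_indep i js e) (subset_card_le sub).
by rewrite -[y j l]/(eval l j) -kl /eval jk.
Qed.

Let X := range eval.

Lemma eval_range k : eval k \in X.
Proof. by rewrite inE; exists k. Qed.

Definition point_of k : set_type X := SigSub (eval_range k).

Lemma point_of_inj : injective point_of.
Proof. by move=> k l [/eval_inj]. Qed.

Lemma point_of_surj x : exists k, point_of k = x.
Proof. by have [k _ kx] := set_valP x; exists k; apply: val_inj. Qed.

Lemma dense_range_eval : dense X.
Proof.
move=> U [z Uz] oU; have [js jsU] := open_cylinder oU Uz.
have [k0 _] := infinite_setN0 K_infinite.
have /card_le_funP[g [gz _]] := y_indep i0 js z.
by exists (eval (g k0)); split; [apply: jsU; have [] := gz k0|exists (g k0)].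
Qed.

Lemma card_range_eval : [set: set_type X] #= [set: K].
Proof.
have /choice[f fK] := point_of_surj.
apply/card_eqPle; split; apply/card_le_typeP.
  by exists f; apply: can_inj fK.
by exists point_of; exact: point_of_inj.
Qed.

(* The inverse bijection of [point_of], by which the pieces are moved to [X]. *)
Variable rank : set_type X -> K.
Hypothesis rankK : cancel rank point_of.

Let piece' x := piece (rank x).

Let point_ofK : cancel point_of rank.
Proof. by move=> k; apply: point_of_inj; rewrite rankK. Qed.

Lemma eval_piece_large i (U : set (set_type X)) : open U -> U !=set0 ->
  [set: K] #<= piece' @^-1` [set i] `&` U.
Proof.
move=> [V oV <-] [x Vx]; have [js jsV] := open_cylinder oV Vx.
have /card_le_funP[g [gx g_inj]] := y_indep i js (val x).
apply/card_le_funP; exists (point_of \o g); split=> [k|].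
  have [ik xk] := gx k; split; first by rewrite /= /piece' point_ofK.
  exact: jsV.
by apply: inj_comp g_inj; exact: point_of_inj.
Qed.

Lemma eval_forced (A : set (set_type X)) : closed A \/
  exists i U, [/\ open U, U !=set0 & piece' @^-1` [set i] `&` U `<=` A].
Proof.
have [[i [js [e [[k [ik ek]] sub]]]]|cl] := y_forces (point_of @^-1` A).
  right; exists i, (set_val @^-1` cylinder js e); split.
  - by exists (cylinder js e) => //; exact: cylinder_open.
  - by exists (point_of k).
  move=> x [/= ix ex]; rewrite -(rankK x); apply: sub; split=> // j /ex <-.
  by rewrite -{2}(rankK x).
left; rewrite -[A]setCK; apply: open_closedC.
pose J := [set j | forall a, A (point_of a) -> ~~ y j a].
exists (\bigcup_(j in J) cylinder [:: j] (fun=> true)).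
  by apply: bigcup_open => j _; exact: cylinder_open.
apply/seteqP; split=> x; rewrite -(rankK x).
  move=> [j Jj jx] Ax; have /negP := Jj _ Ax; apply.
  exact: (jx j (mem_head _ _)).
move=> /cl[j [jx jA]]; exists j => // j'; rewrite inE => /eqP ->.
exact: jx.
Qed.

End evaluation.

Theorem theorem4p5 (M K : Type)
  (M_infinite : infinite_set [set: M]) (K_infinite : infinite_set [set: K])
  (M_lt_K : card_lt [set: M] [set: K]) :
  exists X : set (cantor_cube (set K)),
    [/\ C_space K X,
        disjoint_union_of_dense_submaximal (set_type X) M,
        forall L : Type, is_card_succ M L ->
          ~ extraresolvable (set_type X) L,
        resolvable (set_type X) M &
        (forall L : Type, is_card_succ M L -> ~ resolvable (set_type X) L) /\
        ~ maximally_resolvable (set_type X)].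
Proof.
have [i0 _] := infinite_setN0 M_infinite.
have [piece [x x_indep]] := independent_family i0 K_infinite (proj1 M_lt_K).
have [tag tag_surj] := tagging_surjective K_infinite.
have [y [y_indep y_forces]] := maximal_closing K_infinite tag_surj x_indep.
have Xdense := dense_range_eval i0 K_infinite y_indep.
have XK := card_range_eval K_infinite y_indep y_forces.
have Xccc := dense_ccc (@cantor_cube_ccc (set K)) Xdense.
have /choice[rank rankK] := @point_of_surj K y.
have large := eval_piece_large K_infinite y_indep y_forces rankK.
have forced := eval_forced y_forces rankK.
have not_extra L : is_card_succ M L -> ~ extraresolvable (set_type (range (eval y))) L.
  move=> [ML _].
  exact: (forced_not_extraresolvable i0 K_infinite large forced XK Xccc).
exists (range (eval y)); split.
- split=> //.
  + exact: forced_nodec large forced.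
  + exact: forced_nwd large forced _.
  + exact: forced_Delta large _.
- exact: forced_disjoint_union large forced _.
- exact: not_extra.
- exact: forced_resolvable large forced _.
split.
  by move=> L ML /resolvable_extraresolvable; exact: not_extra.
exact: (forced_not_maximally_resolvable i0 K_infinite large forced).
Qed.
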